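(* Let $K$ be a strictly positive integer and let $(\mu_{n,j})_{n\in\mathbb N,\,0\leq j\leq n}$ be a triangular array in $[0,+\infty[$ such that the following hold: (i) $(\forall n\in\mathbb N)$ $\sum_{j=0}^n\mu_{n,j}=1$. (ii) For every $n\in\mathbb N$ and every $j\in\{0,\ldots,n\}$, if $n-j\geq K$ then $\mu_{n,j}=0$. (iii) $\inf_{n\in\mathbb N}\mu_{n,n}>0$. Then $(\mu_{n,j})_{n\in\mathbb N,\,0\leq j\leq n}$ is a concentrating array.
   Context: A triangular array $(\mu_{n,j})_{n\in\mathbb N,\,0\leq j\leq n}$ in $[0,+\infty[$ is concentrating if: [a] $\sum_{j=0}^n\mu_{n,j}=1$ for every $n\in\mathbb N$; [b] $\lim_{n\to+\infty}\mu_{n,j}=0$ for every $j\in\mathbb N$; [c] every sequence $(\xi_n)_{n\in\mathbb N}$ in $[0,+\infty[$ that satisfies $\xi_{n+1}\leq\sum_{j=0}^n\mu_{n,j}\xi_j+\varepsilon_n$ for every $n\in\mathbb N$, for some summable sequence $(\varepsilon_n)_{n\in\mathbb N}$ in $[0,+\infty[$, converges. *)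

(* Defs.v *)
From mathcomp Require Import all_boot all_order all_algebra.
From mathcomp Require Import all_classical all_reals all_analysis.

Set Implicit Arguments.
Unset Strict Implicit.
Unset Printing Implicit Defensive.

Import Order.TTheory GRing.Theory Num.Theory.
Import numFieldNormedType.Exports.

Local Open Scope classical_set_scope.
Local Open Scope ring_scope.

(* A triangular array (mu_{n,j})_{0 <= j <= n} is encoded as a total function
   [mu : nat -> nat -> R] of which only the entries with j <= n are meaningful:
   nothing is assumed about [mu n j] for n < j. *)
Definition nonneg_triangular_array (R : realType) (mu : nat -> nat -> R) : Prop :=
  forall n j : nat, (j <= n)%N -> 0 <= mu n j.

Definition nonneg_seq (R : realType) (u : nat -> R) : Prop :=
  forall n : nat, 0 <= u n.

Record concentrating (R : realType) (mu : nat -> nat -> R) : Prop := Concentrating {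
  concentrating_ge0 : nonneg_triangular_array mu ;
  concentrating_sum1 : forall n : nat, \sum_(0 <= j < n.+1) mu n j = 1 ;
  (* Junk entries do not matter here: for fixed j, j <= n eventually. *)
  concentrating_col0 : forall j : nat, mu n j @[n --> \oo] --> (0 : R) ;
  concentrating_cvg : forall xi : nat -> R, nonneg_seq xi ->
    (exists eps : nat -> R,
       [/\ nonneg_seq eps,
           cvgn (series eps) &
           forall n : nat,
             xi n.+1 <= (\sum_(0 <= j < n.+1) mu n j * xi j) + eps n]) ->
    cvgn xi
}.

(* Main.v *)
(** Subtracting the partial sums of [eps] from [xi] reduces the recursion to
    [y n.+1 <= \sum_j mu n j * y j] with [y] bounded below. The maximum [M n]
    of [y] over the last [K] indices is then nonincreasing, hence convergent,
    and with [a := inf mu n n] one has [M N - y n.+1 >= a * (M N - y n)] for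
    [n >= N]. Iterating this over a full window gives
    [a ^+ K * (M N - y N) <= M N - M (N + K)], which tends to [0]; so [y] has
    the same limit as [M]. *)
Require Import Defs.
From mathcomp Require Import all_boot all_order all_algebra.
From mathcomp Require Import all_classical all_reals all_analysis.
From mathcomp Require Import zify ring lra.

Import Order.TTheory GRing.Theory Num.Theory.
Import numFieldNormedType.Exports.

Local Open Scope classical_set_scope.
Local Open Scope ring_scope.

(* For [n < i] the truncated [n - i] is [0], so early windows only repeat [y 0]. *)
Definition window_max {R : realType} (K : nat) (y : nat -> R) (n : nat) : R :=
  \big[Num.max/y n]_(i < K) y (n - i)%N.

Lemma window_max_ge {R : realType} (K : nat) (y : nat -> R) (n j : nat) :
  (j <= n)%N -> (n - j < K)%N -> y j <= window_max K y n.
Proof.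
move=> jn nj; rewrite -{1}(subKn jn).
exact: (le_bigmax _ (fun i : 'I_K => y (n - i)%N) (Ordinal nj)).
Qed.

Lemma window_max_le {R : realType} (K : nat) (y : nat -> R) (n : nat) (c : R) :
  (0 < K)%N -> (forall i, (i < K)%N -> y (n - i)%N <= c) ->
  window_max K y n <= c.
Proof.
move=> K0 yc; apply/bigmax_leP; split => [|i _]; last exact: yc.
(* The seed [y n] of the maximum is its entry [i = 0], as [0 < K]. *)
by have := yc 0%N K0; rewrite subn0.
Qed.

Section banded_averages.
Context {R : realType} (K : nat) (mu : nat -> nat -> R) (a : R).
Hypothesis K_gt0 : (0 < K)%N.
Hypothesis mu_ge0 : nonneg_triangular_array mu.
Hypothesis mu_sum1 : forall n : nat, \sum_(0 <= j < n.+1) mu n j = 1.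
Hypothesis mu_band :
  forall n j : nat, (j <= n)%N -> (K <= n - j)%N -> mu n j = 0.
Hypothesis a_gt0 : 0 < a.
Hypothesis a_le_diag : forall n, a <= mu n n.

Lemma diag_bound_le1 : a <= 1.
Proof. by have := mu_sum1 0; rewrite big_nat1 => <-. Qed.

Variable y : nat -> R.
Hypothesis y_rec : forall n, y n.+1 <= \sum_(0 <= j < n.+1) mu n j * y j.

Local Notation M := (window_max K y).

Lemma le_window_max n : y n <= M n.
Proof. by apply: window_max_ge; rewrite ?subnn. Qed.

(** Off the diagonal, [y j] is at most [M n] inside the band and has weight [0] outside it. As
    [y n <= M n], lowering the diagonal weight to [a] can only raise the bound. *)
Lemma rec_diag_le n : y n.+1 <= a * y n + (1 - a) * M n.
Proof.
apply: (le_trans (y_rec n)).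
have off_diag : \sum_(0 <= j < n) mu n j * y j <=
    (\sum_(0 <= j < n) mu n j) * M n.
  rewrite big_distrl /= ler_sum_nat // => j /andP[_ jn].
  have [Knj|njK] := leqP K (n - j).
    by rewrite mu_band ?mul0r // ltnW.
  by rewrite ler_wpM2l ?mu_ge0 ?window_max_ge // ltnW.
have := mu_sum1 n; rewrite !big_nat_recr //= => sum1.
have := le_window_max n; have := a_le_diag n.
set s := \sum_(_ <= _ < _) mu n _ in off_diag sum1 *.
have sE : s = 1 - mu n n by lra.
rewrite sE in off_diag.
(* The slack is [(mu n n - a) * (M n - y n) >= 0]. *)
nra.
Qed.

Lemma window_max_nonincreasing : nonincreasing_seq M.
Proof.
apply/nonincreasing_seqP => n; apply: window_max_le => // -[_|i iK].
  rewrite subn0; apply: (le_trans (rec_diag_le n)).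
  by have := ler_wpM2l (ltW a_gt0) (le_window_max n); lra.
rewrite subSS; have [ni|ni] := leqP i n.
  by apply: window_max_ge; lia.
(* Truncated case: both sides are [0], and [n < i < K] puts index [0] in the window at [n]. *)
have -> : (n - i = n - n)%N by lia.
by apply: window_max_ge; lia.
Qed.

(** The gap is measured from the fixed level [M N], which dominates [M (N + k)], so each step keeps
    at least a fraction [a] of it. *)
Lemma window_gap_pow N k : a ^+ k * (M N - y N) <= M N - y (N + k)%N.
Proof.
elim: k => [|k IH]; first by rewrite expr0 mul1r addn0.
rewrite addnS exprS -mulrA.
have := ler_wpM2l (ltW a_gt0) IH.
have a_co : 0 <= 1 - a by rewrite subr_ge0 diag_bound_le1.
have := ler_wpM2l a_co (window_max_nonincreasing _ _ (leq_addr k N)).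
have := rec_diag_le (N + k); lra.
Qed.

Lemma window_max_drop N : a ^+ K * (M N - y N) <= M N - M (N + K)%N.
Proof.
rewrite lerBrDr -lerBrDl; apply: window_max_le => // i iK.
(* Each entry of the window at [N + K] lies [K - i] steps after [N], and [a ^+ K <= a ^+ (K - i)]
   because [a <= 1]. *)
rewrite -addnBA ?(ltnW iK) // lerBrDl -lerBrDr.
apply: le_trans (window_gap_pow N (K - i)); rewrite ler_wpM2r //.
  by rewrite subr_ge0 le_window_max.
by rewrite ler_wiXn2l ?leq_subr ?diag_bound_le1 // ltW.
Qed.

Lemma banded_rec_cvgn (c : R) : (forall n, c <= y n) -> cvgn y.
Proof.
move=> cy.
have M_cvg : cvgn M.
  apply: nonincreasing_is_cvgn; first exact: window_max_nonincreasing.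
  by exists c => _ [n _ <-]; apply: le_trans (cy n) (le_window_max n).
have MK_cvg : M (n + K)%N @[n --> \oo] --> limn M by rewrite cvg_shiftn.
have aK_gt0 : 0 < a ^+ K by rewrite exprn_gt0.
apply/cvg_ex; exists (limn M).
(* The lower bound is [window_max_drop] solved for [y n]. *)
apply: (@squeeze_cvgr _ _ _ _
  (fun n => M n - (a ^+ K)^-1 * (M n - M (n + K)%N)) M) => //.
  near=> n; rewrite le_window_max andbT lerBlDr -lerBlDl.
  by rewrite ler_pdivlMl // window_max_drop.
rewrite -[X in _ --> X]subr0 -(mulr0 (a ^+ K)^-1) -(subrr (limn M)).
by apply: cvgB => //; apply: cvgM; [exact: cvg_cst|exact: cvgB].
Unshelve. all: by end_near.
Qed.

End banded_averages.

Theorem proposition2p3 (R : realType) (K : nat) (hK : (0 < K)%N)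
  (mu : nat -> nat -> R)
  (mu_ge0 : nonneg_triangular_array mu)
  (mu_sum1 : forall n : nat, \sum_(0 <= j < n.+1) mu n j = 1)
  (mu_band : forall n j : nat, (j <= n)%N -> (K <= n - j)%N -> mu n j = 0)
  (mu_diag : 0 < inf (range (fun n : nat => mu n n))) :
  concentrating mu.
Proof.
split => // [j|xi xi_ge0 [eps [eps_ge0 eps_cvg xi_rec]]].
  apply: cvg_near_cst; near=> n.
  have jKn : (j + K <= n)%N by near: n; exact: nbhs_infty_ge.
  by apply: mu_band; lia.
have inf_le_diag n : inf (range (fun n => mu n n)) <= mu n n.
  apply: ge_inf; last by exists n.
  by exists 0 => _ [m _ <-]; exact: mu_ge0.
set s := series eps.
have s_nondecr : nondecreasing_seq s.
  by apply: nondecreasing_series => n _ _; exact: eps_ge0.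
have y_rec n : xi n.+1 - s n.+1 <=
    \sum_(0 <= j < n.+1) mu n j * (xi j - s j).
  (* Since [s] is nondecreasing, averaging it over a row gives at most [s n]; the increment
     [s n.+1 - s n] then absorbs [eps n]. *)
  have weighted_s : \sum_(0 <= j < n.+1) mu n j * s j <= s n.
    rewrite -[leRHS]mul1r -(mu_sum1 n) big_distrl /= ler_sum_nat // => j.
    by move=> /andP[_ jn]; rewrite ler_wpM2l ?mu_ge0 ?s_nondecr.
  under eq_bigr do rewrite mulrBr.
  rewrite sumrB; have := xi_rec n.
  have -> : s n.+1 = s n + eps n by rewrite /s !seriesEnat /= big_nat_recr.
  lra.
have y_cvg : cvgn (xi \- s).
  (* The lower bound [- limn s] comes from [0 <= xi n] and [s n <= limn s]. *)
  apply: (banded_rec_cvgn _ _ _ hK mu_ge0 mu_sum1 mu_band mu_diag inf_le_diag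
           _ y_rec (- limn s)) => n.
  have := nondecreasing_cvgn_le s_nondecr eps_cvg n.
  have := xi_ge0 n; rewrite /=; lra.
have -> : xi = (xi \- s) \+ s by apply/funext => n /=; rewrite subrK.
exact: is_cvgD.
Unshelve. all: by end_near.
Qed.
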